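(* Let $\beta>0$, let $V_{th}\ge 0$, let $\phi:(V_{th},\infty)\to(0,\infty)$ be a function, and let $V_s>V_{th}$. Let $t_1<t_2<t_3<\cdots$ be real numbers, let $V_2<V_3<\cdots$ be stress levels, and let $k\ge 2$ be the index at which the threshold is crossed, i.e. $V_k>V_{th}$ and $V_{k-1}\le V_{th}$ (the latter condition being void if $k=2$). For $T_s>0$ let $G(t\mid t>t_1;T_s)$ denote the conditional distribution function of the Weibull cumulative exposure model with pre-test usage time $T_s$ at normal stress $V_s$, as defined in the context. Let $0<T_a<T_b$. Then for every $t>t_{k-1}$ (lying in some test stage $(t_{i-1},t_i]$ with $i\ge k$) the following hold. (i) If $0<\beta<1$, then $G(t\mid t>t_1;T_a)>G(t\mid t>t_1;T_b)$. (ii) If $\beta=1$, then $G(t\mid t>t_1;T_a)=G(t\mid t>t_1;T_b)$. (iii) If $\beta>1$, then $G(t\mid t>t_1;T_a)<G(t\mid t>t_1;T_b)$.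
   Context: Weibull cumulative exposure model with a threshold parameter, for a multiple-step step-stress test. A specimen is used for a time $T_s>0$ at the normal stress $V_s$ before the test; the test starts at time $t_1$. At the $(i-1)$-st stage of the test ($i=2,3,\ldots$), which occupies the time interval $(t_{i-1},t_i]$, the specimen is subjected to stress $V_i$, where $V_2<V_3<\cdots$. Stresses not exceeding the threshold $V_{th}$ have no effect on the specimen; it is assumed that $V_s>V_{th}$. At a constant stress $V>V_{th}$ the lifetime distribution is Weibull with shape parameter $\beta$ and scale parameter $\phi(V)>0$, i.e. $W(t;V)=1-\exp[-(t/\phi(V))^{\beta}]$. With $k$ the index such that $V_{k-1}\le V_{th}<V_k$, the accumulated exposure is $$\varepsilon(t)=\frac{T_s}{\phi(V_s)}+\sum_{m=k}^{i-1}\frac{t_m-t_{m-1}}{\phi(V_m)}+\frac{t-t_{i-1}}{\phi(V_i)}\qquad (t_{i-1}<t\le t_i,\ i\ge k),$$ and $\varepsilon(t)=T_s/\phi(V_s)$ for $t_1\le t\le t_{k-1}$; in particular $\varepsilon(t_1)=T_s/\phi(V_s)$. The unconditional distribution function of the failure time is $G(t)=1-\exp[-\varepsilon(t)^{\beta}]$ for $t\ge t_1$. The distribution function conditional on the specimen not having failed before the test is, for $t>t_1$, $$G(t\mid t>t_1)=\frac{G(t)-G(t_1)}{1-G(t_1)}=1-\exp\left[\varepsilon(t_1)^{\beta}-\varepsilon(t)^{\beta}\right],$$ and it is $0$ for $t\le t_1$. It is written $G(t\mid t>t_1;T_s)$ to display its dependence on $T_s$, all other quantities ($V_s$, $V_{th}$,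 $\beta$, $\phi$, the $t_i$ and the $V_i$) being fixed. *)

(* Defs.v *)
From mathcomp Require Import all_boot all_order all_algebra.
From mathcomp Require Import all_classical all_reals all_analysis.

Set Implicit Arguments.
Unset Strict Implicit.
Unset Printing Implicit Defensive.

Import Order.TTheory GRing.Theory Num.Theory.
Local Open Scope ring_scope.
Local Open Scope classical_set_scope.

(* Sequences are indexed as in the usual presentation: [t i] is relevant for
   [1 <= i] and [V i] for [2 <= i], stage [i] being the time interval
   ]t (i-1), t i].  The values [t 0], [V 0], [V 1] carry no meaning. *)

(* The index [i] of the stage containing [x]; it is unique when [t] is
   increasing, and 0 when there is none. *)
Definition stage (R : realType) (t : nat -> R) (x : R) : nat :=
  xget 0%N [set i | (2 <= i)%N /\ t i.-1 < x <= t i].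

(* Only meaningful for [t 1 <= x]. *)
Definition exposure (R : realType) (phi : R -> R) (Vs : R)
    (t V : nat -> R) (k : nat) (Ts x : R) : R :=
  if x <= t k.-1 then Ts / phi Vs
  else let i := stage t x in
    Ts / phi Vs + \sum_(k <= m < i) (t m - t m.-1) / phi (V m)
      + (x - t i.-1) / phi (V i).

Definition failure_cdf (R : realType) (beta : R) (phi : R -> R) (Vs : R)
    (t V : nat -> R) (k : nat) (Ts x : R) : R :=
  1 - expR (- (exposure phi Vs t V k Ts x `^ beta)).

Definition cond_failure_cdf (R : realType) (beta : R) (phi : R -> R) (Vs : R)
    (t V : nat -> R) (k : nat) (Ts x : R) : R :=
  let G := failure_cdf beta phi Vs t V k Ts in
  if x <= t 1%N then 0 else (G x - G (t 1%N)) / (1 - G (t 1%N)).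

(* Main.v *)
(* Put a = Ts / phi Vs.  For x beyond t_(k-1) the exposure at x is a + c, where
   c > 0 is accumulated during the test and does not depend on Ts, so the
   conditional cdf is 1 - exp (- ((a + c)^beta - a^beta)).  By the mean value
   theorem, the monotonicity in a of the increment (a + c)^beta - a^beta is
   decided by the sign of (z + c)^(beta - 1) - z^(beta - 1), that is, of
   beta - 1. *)

Require Import Defs.
From mathcomp Require Import all_boot all_order all_algebra.
From mathcomp Require Import all_classical all_reals all_analysis.
From mathcomp Require Import ring.

Set Implicit Arguments.
Unset Strict Implicit.
Unset Printing Implicit Defensive.

Import Order.TTheory GRing.Theory Num.Theory.
Import numFieldNormedType.Exports.
Local Open Scope ring_scope.

Lemma gt0_ltr_powRN (R : realType) (r u v : R) :
  r < 0 -> 0 < u -> u < v -> v `^ r < u `^ r.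
Proof.
move=> r_lt0 u_gt0 uv; have v_gt0 := lt_trans u_gt0 uv.
rewrite -[r]opprK !(powRN _ (- r)) ltf_pV2 ?posrE ?powR_gt0//.
by rewrite gt0_ltr_powR ?oppr_gt0// nnegrE ltW.
Qed.

(** With [y] the exposure before the test and [c] that of the test, this is the conditional
    cumulative hazard. The exponent is a parameter because differentiating in [y] gives [beta] times
    the same function at [beta - 1]. *)
Definition powR_incr (R : realType) (beta c y : R) : R :=
  (y + c) `^ beta - y `^ beta.

(** Since [a > 0] and [c >= 0], both bases stay positive on the closed interval, where real powers
    are differentiable. *)
Lemma powR_incr_MVT (R : realType) (beta c a b : R) :
    0 < a -> a < b -> 0 <= c ->
  exists2 z, 0 < z & powR_incr beta c b - powR_incr beta c a =
    beta * powR_incr (beta - 1) c z * (b - a).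
Proof.
move=> a_gt0 ab c_ge0.
have drv (y : R) : 0 < y ->
    is_derive y 1 (powR_incr beta c) (beta * powR_incr (beta - 1) c y).
  move=> y_gt0; rewrite mulrBr; apply: is_deriveB; last exact: is_derive1_powR.
  have -> : (fun z : R => (z + c) `^ beta) = (@powR R ^~ beta) \o (fun z : R => z + c) by [].
  have yc_gt0 : 0 < y + c by rewrite ltr_pwDl.
  have dpow : is_derive ((fun z : R => z + c) y) 1 (@powR R ^~ beta)
      (beta * (y + c) `^ (beta - 1)) by exact: is_derive1_powR.
  have dsh : is_derive y 1 (fun z : R => z + c) 1.
    by rewrite -[X in is_derive _ _ _ X]addr0; apply: is_deriveD.
  (* The factor 1 is the derivative of the shift, as the chain rule expects. *)
  rewrite -[X in is_derive _ _ _ X]mulr1.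
  exact: (@is_derive1_comp _ (@powR R ^~ beta) (fun z => z + c)).
have drv_ab y : y \in `]a, b[ ->
    is_derive y 1 (powR_incr beta c) (beta * powR_incr (beta - 1) c y).
  by rewrite in_itv/= => /andP[ay _]; exact/drv/(lt_trans a_gt0).
have [|z z_ab eq_z] := MVT ab drv_ab.
  apply: derivable_within_continuous => y; rewrite in_itv/= => /andP[ay _].
  exact: (@ex_derive _ _ _ _ _ _ _ (drv y (lt_le_trans a_gt0 ay))).
exists z; last exact: eq_z.
by move: z_ab; rewrite in_itv/= => /andP[az _]; exact: lt_trans az.
Qed.

Lemma powR_incr_gt1 (R : realType) (beta c a b : R) :
  1 < beta -> 0 < c -> 0 < a -> a < b -> powR_incr beta c a < powR_incr beta c b.
Proof.
move=> beta_gt1 c_gt0 a_gt0 ab.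
have [z z_gt0 eq_z] := powR_incr_MVT beta a_gt0 ab (ltW c_gt0).
rewrite -subr_gt0 eq_z !mulr_gt0 ?subr_gt0// ?(lt_trans ltr01)//.
by rewrite gt0_ltr_powR ?subr_gt0 ?nnegrE ?ltrDl ?addr_ge0// ltW.
Qed.

(** Here [beta - 1 < 0], so the power in the derivative is decreasing and the increment at [z] is
    negative. *)
Lemma powR_incr_lt1 (R : realType) (beta c a b : R) :
  0 < beta < 1 -> 0 < c -> 0 < a -> a < b ->
  powR_incr beta c b < powR_incr beta c a.
Proof.
move=> /andP[beta_gt0 beta_lt1] c_gt0 a_gt0 ab.
have [z z_gt0 eq_z] := powR_incr_MVT beta a_gt0 ab (ltW c_gt0).
rewrite -subr_lt0 eq_z pmulr_llt0 ?subr_gt0// pmulr_rlt0// subr_lt0.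
by rewrite gt0_ltr_powRN ?subr_lt0// ltrDl.
Qed.

Lemma powR_incr1 (R : realType) (c y : R) :
  0 <= c -> 0 <= y -> powR_incr 1 c y = c.
Proof.
by move=> c_ge0 y_ge0; rewrite /powR_incr !powRr1 ?addr_ge0// addrC addKr.
Qed.

(** Isolates the dependence on [Ts]: the stages from [k] on contribute a constant, positive because
    their stresses exceed [Vth]. *)
Lemma exposure_decomp (R : realType) (Vth Vs : R) (phi : R -> R)
    (t V : nat -> R) (k : nat) (x : R) :
    (forall v : R, Vth < v -> 0 < phi v) ->
    (forall i : nat, (1 <= i)%N -> t i < t i.+1) ->
    (forall i : nat, (2 <= i)%N -> V i < V i.+1) ->
    (2 <= k)%N -> Vth < V k -> t k.-1 < x ->
    (exists2 i : nat, (k <= i)%N & t i.-1 < x <= t i) ->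
  exists2 c, 0 < c & forall Ts, exposure phi Vs t V k Ts x = Ts / phi Vs + c.
Proof.
move=> phi_gt0 t_incr V_incr k_ge2 Vk_gt x_gt [i ki x_i].
have t_le m n : (1 <= m)%N -> (m <= n)%N -> t m <= t n.
  move=> m_ge1 /subnK <-; elim: (n - m)%N => [//|d IH].
  by rewrite addSn (le_trans IH)// ltW// t_incr// ltn_addl.
have V_gt m : (k <= m)%N -> Vth < V m.
  move=> /subnK <-; elim: (m - k)%N => [//|d IH].
  by rewrite addSn (lt_trans IH)// V_incr// ltn_addl.
(* The witness [i] excludes the default value of [xget]. *)
have [j_ge2 /andP[tj_lt tj_ge]] :
    (2 <= stage t x)%N /\ t (stage t x).-1 < x <= t (stage t x).
  rewrite /stage; case: xgetP => [j _ [] //|/(_ i) []].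
  by split => //; exact: leq_trans ki.
set j := stage t x in j_ge2 tj_lt tj_ge.
(* Otherwise [x <= t j <= t k.-1], against [x_gt]. *)
have kj : (k <= j)%N.
  rewrite leqNgt; apply/negP => jk.
  have : t j <= t k.-1 by apply: t_le; [exact: ltnW | rewrite -ltnS prednK// ltnW].
  by move=> /(le_trans tj_ge); rewrite leNgt x_gt.
exists (\sum_(k <= m < j) (t m - t m.-1) / phi (V m)
        + (x - t j.-1) / phi (V j)).
  (* The sum is empty when [j = k]; strict positivity comes from the current stage. *)
  rewrite ltr_wpDl//; last by rewrite divr_gt0 ?subr_gt0// phi_gt0// V_gt.
  rewrite big_nat_cond sumr_ge0// => m /andP[/andP[km _] _].
  rewrite divr_ge0 ?subr_ge0 ?(ltW (phi_gt0 _ (V_gt _ km)))//.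
  apply: t_le; last exact: leq_pred.
  by rewrite -ltnS prednK ?(leq_trans k_ge2 km)// ltnW// (leq_trans k_ge2 km).
by move=> Ts; rewrite /exposure leNgt x_gt/= addrA.
Qed.

Theorem lemma4p1 (R : realType) (beta Vth Vs : R) (phi : R -> R)
    (t V : nat -> R) (k : nat) (Ta Tb x : R)
    (beta_gt0 : 0 < beta)
    (Vth_ge0 : 0 <= Vth)
    (phi_gt0 : forall v : R, Vth < v -> 0 < phi v)
    (Vs_gt : Vth < Vs)
    (t_incr : forall i : nat, (1 <= i)%N -> t i < t i.+1)
    (V_incr : forall i : nat, (2 <= i)%N -> V i < V i.+1)
    (k_ge2 : (2 <= k)%N)
    (Vk_gt : Vth < V k)
    (Vk1_le : (2 < k)%N -> V k.-1 <= Vth)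
    (Ta_gt0 : 0 < Ta)
    (Ta_lt_Tb : Ta < Tb)
    (x_gt : t k.-1 < x)
    (x_stage : exists2 i : nat, (k <= i)%N & t i.-1 < x <= t i) :
  let G (Ts : R) : R := cond_failure_cdf beta phi Vs t V k Ts x in
  [/\ beta < 1 -> G Ta > G Tb,
      beta = 1 -> G Ta = G Tb
    & 1 < beta -> G Ta < G Tb].
Proof.
move=> G.
have [c c_gt0 expoE] :=
  exposure_decomp Vs phi_gt0 t_incr V_incr k_ge2 Vk_gt x_gt x_stage.
(* This puts [x] after the start of the test and makes the exposure at [t 1] equal to
   [Ts / phi Vs]. *)
have t1_le : t 1%N <= t k.-1.
  case: k k_ge2 {Vk_gt Vk1_le x_gt x_stage G expoE} => [|[|k]]// _ /=.
  by elim: k => [//|k IH]; rewrite (le_trans IH)// ltW// t_incr.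
have GE Ts : G Ts = 1 - expR (- powR_incr beta c (Ts / phi Vs)).
  rewrite /G /cond_failure_cdf /failure_cdf leNgt (le_lt_trans t1_le x_gt)/=.
  rewrite expoE /exposure t1_le subKr.
  set a := Ts / phi Vs.
  (* In this form the exponential splits into a quotient whose denominator is the probability of
     surviving until [t 1]. *)
  have -> : - powR_incr beta c a = - (a + c) `^ beta - - a `^ beta.
    by rewrite /powR_incr opprB opprK addrC.
  have e_neq0 : expR (- a `^ beta) != 0 by rewrite gt_eqF ?expR_gt0.
  by rewrite expRB; field.
have phis_gt0 := phi_gt0 _ Vs_gt.
have a_gt0 : 0 < Ta / phi Vs by rewrite divr_gt0.
have ab : Ta / phi Vs < Tb / phi Vs by rewrite ltr_pM2r ?invr_gt0.
(* As [1 - expR (- y)] increases with [y], each case reduces to comparing the increments. *)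
rewrite !GE; split=> beta1.
- by rewrite ltrD2l ltrN2 ltr_expR ltrN2 powR_incr_lt1// beta_gt0.
- by rewrite beta1 !powR_incr1// ltW// (lt_trans a_gt0).
- by rewrite ltrD2l ltrN2 ltr_expR ltrN2 powR_incr_gt1.
Qed.
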